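(* Let $\{u^k=(x^k,y^k,\lambda^k)\}_{k\ge 0}$ be generated by the proximal ADMM (described in the context) under the stated assumptions on the spaces, operators and functions, and assume the minimization problem has a KKT point. Assume $\{u^k\}$ is bounded and let $u^\dagger=(x^\dagger,y^\dagger,\lambda^\dagger)$ be a weak cluster point of $\{u^k\}$. Then $u^\dagger$ is a KKT point of the problem. Moreover, for any weak cluster point $u^*$ of $\{u^k\}$ there holds $\|u^*-u^\dagger\|_G=0$.
   Context: Setting. $\mathcal X,\mathcal Y,\mathcal Z$ are real Hilbert spaces (possibly infinite-dimensional), $c\in\mathcal Z$, $\rho>0$, $A:\mathcal X\to\mathcal Z$ and $B:\mathcal Y\to\mathcal Z$ are bounded linear operators with adjoints $A^*,B^*$, $P:\mathcal X\to\mathcal X$ and $Q:\mathcal Y\to\mathcal Y$ are bounded linear positive semi-definite self-adjoint operators, and $f:\mathcal X\to(-\infty,\infty]$, $g:\mathcal Y\to(-\infty,\infty]$ are proper, lower semi-continuous, convex. For a bounded linear positive semi-definite self-adjoint operator $D$ write $\|u\|_D^2:=\langle u,Du\rangle$. Problem: minimize $H(x,y):=f(x)+g(y)$ subject to $Ax+By=c$. A KKT point is a triple $(\bar x,\bar y,\bar\lambda)\in\mathcal X\times\mathcal Y\times\mathcal Z$ with $-A^*\bar\lambda\in\partial f(\bar x)$, $-B^*\bar\lambda\in\partial g(\bar y)$, $A\bar x+B\bar y=c$. Proximal ADMM: from an arbitrary initial guess $(x^0,y^0,\lambda^0)\in\mathcal X\times\mathcal Y\times\mathcal Z$, for $k\ge0$,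 $$x^{k+1}\in\arg\min_{x\in\mathcal X}\Big\{f(x)+\langle\lambda^k,Ax\rangle+\tfrac{\rho}{2}\|Ax+By^k-c\|^2+\tfrac12\|x-x^k\|_P^2\Big\},$$ $$y^{k+1}\in\arg\min_{y\in\mathcal Y}\Big\{g(y)+\langle\lambda^k,By\rangle+\tfrac{\rho}{2}\|Ax^{k+1}+By-c\|^2+\tfrac12\|y-y^k\|_Q^2\Big\},$$ $$\lambda^{k+1}=\lambda^k+\rho(Ax^{k+1}+By^{k+1}-c),$$ where it is assumed that minimizers of the subproblems exist, so that the sequence is well defined. Notation: $\widehat Q:=\rho B^*B+Q$, $G(x,y,\lambda):=(Px,\widehat Qy,\lambda/\rho)$, so $\|u\|_G^2=\|x\|_P^2+\|y\|_{\widehat Q}^2+\frac1\rho\|\lambda\|^2$ for $u=(x,y,\lambda)$. A weak cluster point of $\{u^k\}$ is a weak limit of some subsequence of $\{u^k\}$ in $\mathcal X\times\mathcal Y\times\mathcal Z$. *)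

(* Defs.v *)
From HB Require Import structures.
From mathcomp Require Import all_boot all_order all_algebra.
From mathcomp Require Import mathcomp_extra boolp classical_sets functions.
From mathcomp Require Import interval_inference reals ereal topology normedtype.
From mathcomp Require Import sequences.
From mathcomp Require Import ring lra.

Set Implicit Arguments.
Unset Strict Implicit.
Unset Printing Implicit Defensive.

Import Order.TTheory GRing.Theory Num.Theory.
Import numFieldNormedType.Exports.

Local Open Scope classical_set_scope.
Local Open Scope ring_scope.

(* Real Hilbert spaces. The positive definite form [inner] is symmetric because
   the twisting morphism of [{dot _ for _}] is the identity. *)
HB.mixin Record CompleteNormedModule_isHilbert (R : realType) V
    of CompleteNormedModule R V := {
  inner : {dot V for @idfun R} ;
  hilbert_normE : forall v : V, `|v| = Num.sqrt (inner v v)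
}.

#[short(type="hilbertType")]
HB.structure Definition Hilbert (R : realType) :=
  {V of CompleteNormedModule_isHilbert R V & CompleteNormedModule R V}.

Notation "''[' u , v ]" := (inner u v) : ring_scope.

Section HilbertTheory.
Variables (R : realType) (V : hilbertType R).
Implicit Types u v w : V.

Lemma innerC u v : '[u, v] = '[v, u].
Proof. by rewrite (hermitian_subproof u v) expr0 mul1r. Qed.

Lemma innerDl u v w : '[u + v, w] = '[u, w] + '[v, w].
Proof. exact: linearDl. Qed.

Lemma innerDr u v w : '[u, v + w] = '[u, v] + '[u, w].
Proof. exact: linearD. Qed.

Lemma innerZl a u v : '[a *: u, v] = a * '[u, v].
Proof. exact: linearZl_LR. Qed.

Lemma innerZr a u v : '[u, a *: v] = a * '[u, v].
Proof. by rewrite innerC innerZl innerC. Qed.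

Lemma innerNl u v : '[- u, v] = - '[u, v].
Proof. by rewrite -scaleN1r innerZl mulN1r. Qed.

Lemma innerNr u v : '[u, - v] = - '[u, v].
Proof. by rewrite innerC innerNl innerC. Qed.

Lemma inner0r u : '[u, 0] = 0.
Proof. by rewrite -(scale0r 0) innerZr mul0r. Qed.

Lemma inner_ge0 u : 0 <= '[u, u].
Proof.
have [->|u0] := eqVneq u 0; first by rewrite inner0r.
exact/ltW/neq0_dnorm_gt0.
Qed.

Lemma normr2_inner u : `|u| ^+ 2 = '[u, u].
Proof. by rewrite hilbert_normE sqr_sqrtr ?inner_ge0. Qed.

Lemma normr2D u v : `|u + v| ^+ 2 = `|u| ^+ 2 + 2 * '[u, v] + `|v| ^+ 2.
Proof. by rewrite !normr2_inner !(innerDl, innerDr) (innerC v u); ring. Qed.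

Lemma cauchy_schwarz u v : '[u, v] <= `|u| * `|v|.
Proof.
have [->|u0] := eqVneq u 0; first by rewrite innerC inner0r normr0 mul0r.
have [->|v0] := eqVneq v 0; first by rewrite inner0r normr0 mulr0.
have uv_gt0 : 0 < `|u| * `|v| by rewrite mulr_gt0 ?normr_gt0.
have := sqr_ge0 (`| (`|v| *: u) + (- (`|u| *: v)) |).
rewrite normr2D normrN !normrZ !normr_id innerNr innerZl innerZr => h.
rewrite -(ler_pM2l uv_gt0); nra.
Qed.

End HilbertTheory.

Section Adjoint.
Variables (R : realType) (X Z : hilbertType R).

(* Meaningful when A is linear and bounded, see [adjointP]. *)
Definition adjoint (A : X -> Z) (z : Z) : X :=
  xget 0 [set x | forall w, '[w, x] = '[A w, z]].

Lemma adjointP (A : {linear X -> Z}) : bounded_near A (nbhs 0) ->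
  forall w z, '[w, adjoint A z] = '[A w, z].
Proof.
move=> Abnd w z; rewrite /adjoint; case: xgetP => [_ _ //|H]; exfalso.
have [x Hx] : exists x : X, forall w, '[w, x] = '[A w, z]; last exact: (H x).
clear w.
move/linear_boundedP: Abnd => /pinfty_ex_gt0[M M0 AM].
pose phi w : R := '[A w, z].
pose J w : R := `|w| ^+ 2 - 2 * phi w.
pose K := M * `|z|.
have phiM w : phi w <= K * `|w|.
  rewrite (le_trans (cauchy_schwarz _ _))// /K mulrAC ler_wpM2r//; exact: AM.
have phiD a b : phi (a + b) = phi a + phi b by rewrite /phi linearD innerDl.
have phiZ t a : phi (t *: a) = t * phi a by rewrite /phi linearZ innerZl.
have Jlb w : - K ^+ 2 <= J w.
  have := phiM w; have := sqr_ge0 (`|w| - K); rewrite /J; nra.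
pose m := inf (range J).
have Jinf : has_inf (range J).
  split; first by exists (J 0), 0.
  by exists (- K ^+ 2) => _ [w _ <-].
have mJ w : m <= J w by apply: ge_inf; [case: Jinf|exists w].
have par a b : `|a - b| ^+ 2 = 2 * J a + 2 * J b - 4 * J (2^-1 *: (a + b)).
  rewrite /J phiZ phiD normrZ exprMn !normr2D normrN innerNr.
  rewrite [`|2^-1|]ger0_norm ?invr_ge0//; by field.
have exn (n : nat) : exists w, J w < m + n.+1%:R^-1.
  have n0 : 0 < n.+1%:R^-1 :> R by rewrite invr_gt0.
  by have [_ [w _ <-] Jw] := inf_adherent n0 Jinf; exists w.
have [v vP] := choice exn.
have vc : cvg (v @ \oo).
  apply: cauchy_cvg; apply/cauchy_ballP => e e0.
  near \oo => N.
  have hN : 4 * N.+1%:R^-1 < e ^+ 2.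
    near: N.
    have e2 : 0 < e ^+ 2 / 4 by rewrite divr_gt0// exprn_gt0.
    have := near_infty_natSinv_lt (PosNum e2); apply: filterS => n /= hn.
    by rewrite mulrC -ltr_pdivlMr.
  have hv n : (N <= n)%N -> J (v n) < m + N.+1%:R^-1.
    move=> Nn; rewrite (lt_le_trans (vP n))// lerD2l lef_pV2 ?posrE//.
    by rewrite ler_nat.
  pose S := [set w | J w < m + N.+1%:R^-1].
  have vS : (v @ \oo) S by exists N => // n /= /hv.
  exists (S, S) => //= -[p q] [/= Ha Hb]; rewrite -ball_normE/=.
  have h1 := mJ (2^-1 *: (p + q)); have h2 := par p q.
  rewrite -(ltr_pXn2r (n := 2))// ?nnegrE ?normr_ge0 ?(ltW e0)//.
  have {}Ha : J p < m + N.+1%:R^-1 := Ha.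
  have {}Hb : J q < m + N.+1%:R^-1 := Hb.
  rewrite h2; set ni := N.+1%:R^-1 in hN Ha Hb.
  move: (J p) (J q) (J _) h1 Ha Hb hN => a b d; lra.
pose l := lim (v @ \oo).
have Jl : J l <= m.
  apply/ler_addgt0Pr => e e0.
  pose C := 2 * `|l| + 3 + 2 * K.
  have K0 : 0 <= K by rewrite mulr_ge0// ltW.
  have C0 : 0 < C by have := normr_ge0 l; rewrite /C; lra.
  have e2 : 0 < e / 2 by rewrite divr_gt0.
  near \oo => n.
  have hn : n.+1%:R^-1 < e / 2.
    by near: n; exact: (near_infty_natSinv_lt (PosNum e2)).
  have d1 : `|l - v n| < 1 by near: n; exact: cvgr_dist_lt.
  have d2 : `|l - v n| < e / 2 / C.
    by near: n; apply: cvgr_dist_lt => //; rewrite divr_gt0.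
  have hd : C * `|l - v n| < e / 2 by rewrite mulrC -ltr_pdivlMr.
  have h0 := vP n; set d := `|l - v n| in d1 d2 hd *.
  have d0 : 0 <= d by exact: normr_ge0.
  have -> : J l = J (v n) + 2 * '[v n, l - v n] + d ^+ 2 - 2 * phi (l - v n).
    have -> : J l = J (v n + (l - v n)) by rewrite addrC subrK.
    by rewrite /J normr2D phiD /d; ring.
  have h1 := cauchy_schwarz (v n) (l - v n); rewrite -/d in h1.
  have h2 : - phi (l - v n) <= K * d.
    by rewrite -mulN1r -phiZ (le_trans (phiM _))// scaleN1r normrN.
  have h3 : `|v n| <= `|l| + d.
    by rewrite -[X in `|X|](subKr l) (le_trans (ler_normB _ _)).
  have h4 : `|v n| * d <= (`|l| + 1) * d.
    by rewrite ler_wpM2r// (le_trans h3)// lerD2l ltW.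
  have h5 : d ^+ 2 <= d by rewrite expr2 ler_piMl// ltW.
  have h6 : (2 * `|l| + 3 + 2 * K) * d < e / 2 := hd.
  set ni := n.+1%:R^-1 in hn h0; clear -h0 hn h1 h2 h4 h5 h6.
  move: (J _) (phi _) ('[_, _]) h0 h1 h2 => j p q h0 h1 h2; lra.
have Jmin t w : 0 <= 2 * t * ('[l, w] - phi w) + t ^+ 2 * `|w| ^+ 2.
  have := le_trans Jl (mJ (l + t *: w)).
  rewrite /J normr2D phiD phiZ innerZr normrZ exprMn real_normK ?num_real//.
  by move=> h; lra.
have le w : '[l, w] <= phi w.
  rewrite leNgt; apply/negP; rewrite -subr_gt0 => dlt.
  pose S := `|w| ^+ 2 + 1; pose t := ('[l, w] - phi w) / S.
  have S0 : 0 < S by rewrite ltr_wpDl// sqr_ge0.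
  have t0 : 0 < t by rewrite divr_gt0.
  have tS : '[l, w] - phi w = t * S by rewrite /t divfK// gt_eqF.
  have := Jmin (- t) w; rewrite tS /S; have := sqr_ge0 `|w|; nra.
exists l => w; apply/eqP; rewrite eq_le innerC le/=.
have := le (- w); rewrite innerNr -scaleN1r phiZ; lra.
Unshelve. all: by end_near. Qed.

End Adjoint.

Section WeakConvergence.
Variables (R : realType) (W : normedModType R).

Definition weak_cvg (u : W ^nat) (l : W) :=
  forall phi : {linear W -> R^o}, continuous phi ->
    (phi \o u) @ \oo --> phi l.

Definition weak_cluster_point (u : W ^nat) (l : W) :=
  exists2 n : nat -> nat, increasing_seq n & weak_cvg (u \o n) l.

End WeakConvergence.

Section ConvexAnalysis.
Variables (R : realType) (X : hilbertType R).
Local Open Scope ereal_scope.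

Definition proper_efun (f : X -> \bar R) :=
  (forall x, f x != -oo) /\ exists x, f x != +oo.

Definition econvex (f : X -> \bar R) :=
  forall (x y : X) (t : R), (0 <= t <= 1)%R ->
    f (t *: x + (1 - t) *: y)%R <= t%:E * f x + (1 - t)%:E * f y.

Definition subdifferential (f : X -> \bar R) (x : X) : set X :=
  [set xi | forall y, f x + '[xi, (y - x)%R]%:E <= f y].

Definition eargmin (F : X -> \bar R) : set X :=
  [set x | forall y, F x <= F y].

End ConvexAnalysis.

Section Operators.
Variables (R : realType) (X : hilbertType R).

Definition psd_selfadjoint (D : X -> X) :=
  (forall u v, '[D u, v] = '[u, D v]) /\ (forall u, 0 <= '[u, D u]).

Definition sqnormD (D : X -> X) (u : X) : R := '[u, D u].

End Operators.

Section ProximalADMM.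
Variables (R : realType) (X Y Z : hilbertType R).
Variables (f : X -> \bar R) (g : Y -> \bar R).
Variables (A : X -> Z) (B : Y -> Z) (P : X -> X) (Q : Y -> Y).
Variables (c : Z) (rho : R).

Definition KKT_point (u : X * Y * Z) :=
  let: (x, y, lam) := u in
  [/\ subdifferential f x (- adjoint A lam),
      subdifferential g y (- adjoint B lam) &
      A x + B y = c].

Definition proximal_ADMM (x : X ^nat) (y : Y ^nat) (lam : Z ^nat) :=
  forall k,
  [/\ eargmin (fun w => f w + ('[lam k, A w]
          + rho / 2 * `|A w + B (y k) - c| ^+ 2
          + 1 / 2 * sqnormD P (w - x k))%:E)%E (x k.+1),
      eargmin (fun w => g w + ('[lam k, B w]
          + rho / 2 * `|A (x k.+1) + B w - c| ^+ 2
          + 1 / 2 * sqnormD Q (w - y k))%:E)%E (y k.+1) &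
      lam k.+1 = lam k + rho *: (A (x k.+1) + B (y k.+1) - c)].

Definition Qhat (v : Y) : Y := rho *: adjoint B (B v) + Q v.

Definition Gop (u : X * Y * Z) : X * Y * Z :=
  (P u.1.1, Qhat u.1.2, rho^-1 *: u.2).

(* The library's norm on products is the max norm, so the Hilbert structure of
   X * Y * Z is given by its inner product only. *)
Definition inner3 (u v : X * Y * Z) : R :=
  '[u.1.1, v.1.1] + '[u.1.2, v.1.2] + '[u.2, v.2].

Definition Gnorm (u : X * Y * Z) : R := Num.sqrt (inner3 u (Gop u)).

End ProximalADMM.

(* Main.v *)
Require Import Defs.
From HB Require Import structures.
From mathcomp Require Import all_boot all_order all_algebra.
From mathcomp Require Import mathcomp_extra boolp classical_sets functions.
From mathcomp Require Import interval_inference reals ereal topology normedtype.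
From mathcomp Require Import sequences.
From mathcomp Require Import ring lra.

Set Implicit Arguments.
Unset Strict Implicit.
Unset Printing Implicit Defensive.

Import Order.TTheory GRing.Theory Num.Theory.
Import numFieldNormedType.Exports.

Local Open Scope classical_set_scope.
Local Open Scope ring_scope.

(** The proximal ADMM is a perturbed proximal point method for the KKT system in
    the degenerate metric of G. Fermat's rule in the two subproblems
    ([prox_subproblem_subdifferential]) turns one step into a variational
    inequality which compares the Lagrangian at the new iterate and at an
    arbitrary point ([step_variational_inequality]), with error terms that
    vanish with the last increment.

    Tested at a KKT point it shows ([descent]) that the squared G-distance to
    that point decreases up to a cross term <B dy, dlam>, which monotonicity of
    the subdifferential of g bounds by a telescoping quantity
    ([cross_term_le]). So the G-norms of the increments are square summable and
    the G-distance of the iterates to every KKT point converges ([fejer_cvg]).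

    Tested at an arbitrary point, its errors vanish in the limit: increments
    are paired with bounded vectors through a positive semi-definite form,
    where the Cauchy-Schwarz inequality applies. As convex lower
    semi-continuous functions are weakly lower semi-continuous along bounded
    sequences ([weak_lower_semicontinuous]), the limit of the inequality says
    that a weak cluster point minimizes the Lagrangian at its own multiplier;
    since the residuals tend to 0 it is also feasible, that is, a KKT point
    ([KKT_saddle], [weak_limit_KKT]).

    Two weak cluster points are then KKT points to which the G-distances of the
    iterates converge. The difference of the two squared distances is affine in
    the iterate, and comparing its limits along the two subsequences forces the
    mutual G-distance of the cluster points to be 0 ([weak_limits_G]). *)

(** * Weak convergence in Hilbert spaces *)

Section Separation.
Variables (R : realType) (X : hilbertType R).
Implicit Types a b l w p : X.

Lemma innerBl a b w : '[a - b, w] = '[a, w] - '[b, w].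
Proof. by rewrite innerDl innerNl. Qed.

Lemma innerBr a b w : '[w, a - b] = '[w, a] - '[w, b].
Proof. by rewrite innerDr innerNr. Qed.

Lemma inner_norm_le a b : `|'[a, b]| <= `|a| * `|b|.
Proof.
rewrite ler_norml cauchy_schwarz andbT lerNl -innerNl.
by rewrite (le_trans (cauchy_schwarz _ _))// normrN.
Qed.

(** The separating functional comes from an approximate projection: if [p]
    nearly minimizes the distance [`|l - p|] over [S], moving from [p] to
    [w] by a small fraction cannot bring it much closer to [l], so that
    ['[l - p, w - p]] is nearly nonpositive, whereas ['[l - p, l - p]] is at
    least the squared distance of [l] to [S]. The error in the first estimate
    is uniform only over bounded [w], whence the radius [M]. *)
Lemma convex_separation (S : set X) l (M : R) :
  closed S ->
  (forall a b (t : R), 0 <= t <= 1 -> S a -> S b -> S (t *: a + (1 - t) *: b)) ->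
  ~ S l ->
  exists v beta, beta < '[v, l] /\
    forall w, S w -> `|w| <= M -> '[v, w] <= beta.
Proof.
move=> Scl Scvx Sl.
have [[p0 Sp0]|S0] := pselect (S !=set0); last first.
  exists 0, (-1); split; first by rewrite innerC inner0r.
  by move=> w Sw; exfalso; apply: S0; exists w.
have [e e0 eS] : exists2 e : R, 0 < e & forall w, S w -> e <= `|l - w|.
  have /nbhs_ballP[e /= e0 eS] : nbhs l (~` S).
    by apply: open_nbhs_nbhs; split => //; exact/closed_openC.
  exists e => // w Sw; rewrite leNgt; apply/negP => lw.
  by apply: (eS w) => //; rewrite -ball_normE.
pose E := [set `|l - w| ^+ 2 | w in S].
have Elb : lbound E (e ^+ 2).
  by move=> _ [w Sw <-]; rewrite ler_sqr ?nnegrE ?(ltW e0)// eS.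
have E0 : E !=set0 by exists (`|l - p0| ^+ 2), p0.
have Einf : has_inf E by split => //; exists (e ^+ 2).
pose d := inf E.
have d0 : 0 < d.
  by rewrite (lt_le_trans _ (lb_le_inf E0 Elb))// exprn_gt0.
have dS w : S w -> d <= `|l - w| ^+ 2.
  by move=> Sw; apply: ge_inf; [case: Einf|exists w].
(* [K] will bound `|w - p| ^+ 2. In the estimate of 2 * '[l - p, w - p] the
   second-order term t * K and the slack t * d / 2 of the choice of [p], divided
   by [t], contribute at most d / 2 each, so that '[l - p, w - p] is at most
   d / 2 while '[l - p, l - p] is at least d; 3 / 4 * d lies in between. *)
pose K := (`|M| + `|l| + d + 2) ^+ 2.
have K0 : 0 < K.
  by rewrite exprn_gt0//; have := normr_ge0 M; have := normr_ge0 l; lra.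
pose t := d / (d + 2 * K).
have dK0 : 0 < d + 2 * K by lra.
have t0 : 0 < t by rewrite divr_gt0.
have t1 : t <= 1 by rewrite ler_pdivrMr//; lra.
have tK : 2 * (t * K) <= d.
  have tdK : t * (d + 2 * K) = d by rewrite divfK// gt_eqF.
  have := mulr_gt0 t0 d0; lra.
have [_ [p Sp <-] pd] : exists2 r, E r & r < d + Num.min 1 (t * d / 2).
  by apply: inf_adherent => //; rewrite lt_min ltr01/= divr_gt0// mulr_gt0.
have [pd1 pd2] : `|l - p| ^+ 2 < d + 1 /\ `|l - p| ^+ 2 < d + t * d / 2.
  split; rewrite (lt_le_trans pd)// lerD2l ge_min ?lexx ?orbT//.
exists (l - p), ('[l - p, p] + 3 / 4 * d); split.
  rewrite -ltrBrDl -innerBr -normr2_inner.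
  by have := dS _ Sp; lra.
move=> w Sw wM; rewrite -lerBlDl -innerBr.
have lpd : `|l - p| <= d + 1.
  by have := normr_ge0 (l - p); nra.
have wpK : `|w - p| ^+ 2 <= K.
  rewrite ler_sqr ?nnegrE//; last first.
    by have := normr_ge0 M; have := normr_ge0 l; lra.
  have -> : w - p = w + (- l + (l - p)) by rewrite addKr.
  rewrite (le_trans (ler_normD _ _))//.
  have := ler_normD (- l) (l - p); rewrite normrN.
  have := ler_norm M; lra.
have := dS _ (Scvx w p t _ Sw Sp).
rewrite (ltW t0) t1 => /(_ isT).
have -> : l - (t *: w + (1 - t) *: p) = (l - p) + (- (t *: (w - p))).
  rewrite scalerBr scalerBl scale1r !opprD !opprK -!addrA; congr (_ + _).
  by rewrite addrC -!addrA; congr (_ + _); rewrite addrC.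
rewrite normr2D normrN normrZ innerNr innerZr exprMn real_normK ?num_real// => h.
have h2 : t * (2 * '[l - p, w - p]) <= t * (d / 2 + t * K) by nra.
by rewrite ler_pM2l// in h2; lra.
Qed.

End Separation.

Section Weak.
Variable R : realType.

Lemma weak_cvg_linear (V W : normedModType R) (T : {linear V -> W}) (u : V ^nat) l :
  continuous T -> weak_cvg u l -> weak_cvg (T \o u) (T l).
Proof.
move=> cT ul phi cphi; pose psi : {linear V -> R^o} := phi \o T.
apply: (ul psi) => v.
by apply: continuous_comp; [exact: cT|exact: cphi].
Qed.

Lemma weak_cvg_inner (X : hilbertType R) (u : X ^nat) l a :
  weak_cvg u l -> '[a, u n] @[n --> \oo] --> '[a, l].
Proof.
pose phi : {linear X -> R^o} := inner a.
move=> /(_ phi); apply; apply: bounded_linear_continuous.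
apply/linear_boundedP; exists `|a|; split; first exact: num_real.
move=> M aM w /=.
by rewrite (le_trans (inner_norm_le _ _))// ler_wpM2r// ltW.
Qed.

Lemma weak_cvg_components (X Y Z : normedModType R)
    (v : (X * Y * Z)%type ^nat) (l : (X * Y * Z)%type) :
  weak_cvg v l ->
  [/\ weak_cvg (fun k => (v k).1.1) l.1.1, weak_cvg (fun k => (v k).1.2) l.1.2
    & weak_cvg (fun k => (v k).2) l.2].
Proof.
pose T1 : {linear (X * Y * Z)%type -> X} := fst \o fst.
pose T2 : {linear (X * Y * Z)%type -> Y} := snd \o fst.
pose T3 : {linear (X * Y * Z)%type -> Z} := snd.
move=> vl; split.
- apply: (weak_cvg_linear (T := T1)) vl => w.
  by apply: continuous_comp; exact: cvg_fst.
- apply: (weak_cvg_linear (T := T2)) vl => w.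
  by apply: continuous_comp; [exact: cvg_fst|exact: cvg_snd].
- by apply: (weak_cvg_linear (T := T3)) vl => w; exact: cvg_snd.
Qed.

Lemma weak_cvg_inner3 (X Y Z : hilbertType R)
    (v : (X * Y * Z)%type ^nat) (l w : X * Y * Z) :
  weak_cvg v l -> inner3 (v k) w @[k --> \oo] --> inner3 l w.
Proof.
move=> vl.
have [v1 v2 v3] := weak_cvg_components vl.
by rewrite /inner3; apply: cvgD; first apply: cvgD;
  rewrite innerC; under eq_fun do rewrite innerC; exact: weak_cvg_inner.
Qed.

(** The optimality conditions of the algorithm hold for the iterates of index at
    least one only, hence subsequences are taken of the shifted sequence. *)
Lemma weak_cluster_shift (W : normedModType R) (u : W ^nat) l :
  weak_cluster_point u l ->
  exists2 m : nat -> nat, m @ \oo --> \oo & weak_cvg (fun k => u (m k).+1) l.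
Proof.
move=> [n n_incr ul].
have n_ge k : (k <= n k)%N.
  elim: k => // k ih; rewrite (leq_ltn_trans ih)//.
  by move/increasing_seqP : n_incr; exact.
exists (fun k => (n k.+1).-1).
  apply/cvgnyPge => N; near=> k.
  rewrite -ltnS prednK; last exact: leq_trans (n_ge k.+1).
  rewrite (leq_trans _ (n_ge k.+1))// ltnS.
  by near: k; exists N.
move=> phi cphi.
have -> : phi \o (fun k => u (n k.+1).-1.+1) = [sequence (phi \o (u \o n)) k.+1]_k.
  by apply/funext => k /=; rewrite prednK//; exact: leq_trans (n_ge k.+1).
by rewrite cvg_shiftS; exact: ul.
Unshelve. all: by end_near. Qed.

End Weak.

(** * Convex functions and their subdifferentials *)

Section Convex.
Variables (R : realType) (X : hilbertType R) (f : X -> \bar R).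
Local Open Scope ereal_scope.

Lemma econvex_sublevel (a : R) (x y : X) (t : R) : econvex f ->
  (0 <= t <= 1)%R -> f x <= a%:E -> f y <= a%:E ->
  f (t *: x + (1 - t) *: y)%R <= a%:E.
Proof.
move=> fcvx t01 fx fy; apply: (le_trans (fcvx x y t t01)).
have /andP[t0 t1] := t01.
have -> : a%:E = t%:E * a%:E + (1 - t)%:E * a%:E.
  by rewrite -!EFinM -EFinD; congr EFin; ring.
by apply: leeD; apply: lee_wpmul2l; rewrite ?lee_fin ?subr_ge0.
Qed.

(** The sublevel sets of [f] are closed and convex, so a level below [f l] is
    separated from [l] by a continuous linear functional, along which [u]
    converges. *)
Lemma weak_lower_semicontinuous (u : X ^nat) l (M a : R) :
  lower_semicontinuous f -> econvex f ->
  (forall n, (`|u n| <= M)%R) -> weak_cvg u l ->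
  a%:E < f l -> \forall n \near \oo, a%:E < f (u n).
Proof.
move=> flsc fcvx uM ul al.
have [|||v [beta [betal Sv]]] :=
    @convex_separation R X [set x | f x <= a%:E] l M.
- rewrite (_ : [set x | _] = ~` [set x | a%:E < f x]).
    by apply: open_closedC; move/lower_semicontinuousP : flsc; exact.
  by apply/seteqP; split => x /=; [rewrite leNgt => /negP|move/negP; rewrite -leNgt].
- by move=> x y t t01 fx fy; exact: econvex_sublevel.
- by apply/negP; rewrite -ltNge.
apply: filterS (cvgr_gt _ (weak_cvg_inner (a := v) ul) _ betal) => n bn.
rewrite ltNge; apply/negP => fun_.
by move: bn; rewrite ltNge Sv.
Qed.

Lemma eargmin_fin_num (q : X -> R) x : proper_efun f ->
  eargmin (fun w => f w + (q w)%:E) x -> f x \is a fin_num.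
Proof.
move=> [fNy [x0 fx0]] /(_ x0) xx0; rewrite fin_numE fNy/=.
apply/negP => /eqP fx; move: xx0; rewrite fx addye// leye_eq.
by case: (f x0) (fNy x0) fx0.
Qed.

(** Fermat's rule for a convex function plus a quadratic one: compare the
    minimizer [x] with [x + t *: (w - x)], bound [f] there by convexity, divide
    by [t] and let it tend to 0. *)
Lemma eargmin_subdifferential (q C : X -> R) x v :
  proper_efun f -> econvex f ->
  eargmin (fun w => f w + (q w)%:E) x ->
  (forall h (t : R),
     (q (x + t *: h) = q x + t * '[v, h] + t ^+ 2 * C h)%R) ->
  subdifferential f x (- v)%R.
Proof.
move=> fp fcvx xmin qE w.
have := eargmin_fin_num fp xmin; case fxE : (f x) => [a| |]// _.
case fwE : (f w) => [b| |]; [|by rewrite leey|by case: fp => /(_ w); rewrite fwE].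
set h := (w - x)%R.
rewrite -EFinD lee_fin; apply/ler_addgt0Pr => e e0.
pose K : R := (`|C h| + 1)%R; pose t : R := Num.min 1%R (e / K)%R.
have K0 : (0 < K)%R by rewrite ltr_wpDl.
have t0 : (0 < t)%R by rewrite lt_min ltr01 divr_gt0.
have t1 : (t <= 1)%R by rewrite ge_min lexx.
have tK : (t * K <= e)%R by rewrite -ler_pdivlMr// ge_min lexx orbT.
have := xmin (x + t *: h)%R; rewrite qE fxE.
have : f (x + t *: h)%R <= (t * b + (1 - t) * a)%:E.
  have -> : (x + t *: h = t *: w + (1 - t) *: x)%R.
    by rewrite /h scalerBr scalerBl scale1r addrCA.
  have := fcvx w x t; rewrite fwE fxE -!EFinM -EFinD; apply.
  by rewrite (ltW t0).
case: (f (x + t *: h)%R) => [r| |]; rewrite -?EFinD ?lee_fin//=.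
rewrite innerNl => h1 h2.
have tC : (t * C h <= e)%R.
  by rewrite (le_trans _ tK)// ler_pM2l// (le_trans (ler_norm _))// lerDl.
have : (t * (a - '[v, h]) <= t * (b + e))%R by nra.
by rewrite ler_pM2l.
Qed.

End Convex.

Lemma subdifferential_add (R : realType) (X Y : hilbertType R)
    (f : X -> \bar R) (g : Y -> \bar R) (x x' xi : X) (y y' eta : Y) :
  subdifferential f x xi -> subdifferential g y eta ->
  (f x + g y <= f x' + g y' - ('[xi, x' - x] + '[eta, y' - y])%:E)%E.
Proof.
move=> /(_ x') fx /(_ y') gy; rewrite leeBrDr// EFinD addeACA.
exact: leeD.
Qed.

Lemma subdifferential_monotone (R : realType) (X : hilbertType R)
    (f : X -> \bar R) (x y xi eta : X) :
  f x \is a fin_num -> f y \is a fin_num ->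
  subdifferential f x xi -> subdifferential f y eta -> 0 <= '[xi - eta, x - y].
Proof.
move=> fx fy fxi feta; have := subdifferential_add y x fxi feta.
rewrite addeC -{1}(adde0 (f y + f x)%E) leeD2lE ?fin_numD ?fy ?fx//.
by rewrite -EFinN lee_fin !(innerBl, innerBr); lra.
Qed.

Section Prox.
Variables (R : realType) (X Z : hilbertType R) (f : X -> \bar R).
Variables (A : {linear X -> Z}) (P : {linear X -> X}).

(** Both subproblems of the algorithm have this form, the vector [b] collecting
    the terms of the residual which do not depend on the unknown. *)
Lemma prox_subproblem_subdifferential (rho : R) (l b : Z) (x0 x : X) :
  bounded_near A (nbhs 0) -> psd_selfadjoint P ->
  proper_efun f -> econvex f ->
  eargmin (fun w => f w + ('[l, A w] + rho / 2 * `|A w + b| ^+ 2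
    + 1 / 2 * sqnormD P (w - x0))%:E)%E x ->
  subdifferential f x (- (adjoint A (l + rho *: (A x + b)) + P (x - x0))).
Proof.
move=> Ab [Psym _] fp fcvx xmin.
apply: (eargmin_subdifferential (C := fun h =>
  rho / 2 * `|A h| ^+ 2 + 1 / 2 * '[h, P h]) fp fcvx xmin) => h t.
have -> : x + t *: h - x0 = x - x0 + t *: h by rewrite addrAC.
have -> : A (x + t *: h) + b = A x + b + t *: A h.
  by rewrite linearD linearZ addrAC.
move: (x - x0) => d.
rewrite !linearD !linearZ/= /sqnormD !linearD !linearZ/=.
rewrite !normr2_inner !(innerDl, innerDr, innerZl, innerZr).
rewrite (innerC (adjoint A _)) adjointP// !(innerDl, innerDr, innerZl, innerZr).
rewrite Psym (innerC (A h) (A x)) (innerC (A h) b) (innerC (A h) l).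
have -> : '[h, P d] = '[d, P h] by rewrite -Psym innerC.
by rewrite (innerC b (A x)); field.
Qed.

End Prox.

(** * KKT points and the Lagrangian *)

Section Saddle.
Variables (R : realType) (X Y Z : hilbertType R).
Variables (f : X -> \bar R) (g : Y -> \bar R).
Variables (A : {linear X -> Z}) (B : {linear Y -> Z}) (c : Z).
Local Open Scope ereal_scope.

Hypotheses (Ab : bounded_near A (nbhs 0%R)) (Bb : bounded_near B (nbhs 0%R)).
Hypotheses (fp : proper_efun f) (gp : proper_efun g).

(** The two stationarity conditions amount to minimality of the Lagrangian at
    [l], and this single inequality passes to weak limits: it is affine in the
    multiplier and the objective appears only as the sum f x + g y. *)
Lemma KKT_saddle x y l : KKT_point f g A B c (x, y, l) <->
  (A x + B y = c)%R /\
  forall x' y', f x + g y <= f x' + g y' + ('[l, A x' + B y' - c])%:E.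
Proof.
split=> [[fx gy Exy]|[Exy xy]].
  split=> // x' y'; apply: (le_trans (subdifferential_add x' y' fx gy)).
  rewrite leeD2l// -EFinN lee_fin !innerNl !(innerC (adjoint _ _)) !adjointP//.
  rewrite -Exy !linearB/= !(innerDl, innerDr, innerNl, innerNr).
  by rewrite !(innerC _ l); lra.
have [fxfin gyfin] : f x \is a fin_num /\ g y \is a fin_num.
  have [fNy [x0 fx0]] := fp; have [gNy [y0 gy0]] := gp.
  have := xy x0 y0; have := fNy x; have := gNy y; have := fNy x0; have := gNy y0.
  move: fx0 gy0.
  by case: (f x) (g y) (f x0) (g y0) => [?| |] [?| |] [?| |] [?| |].
split=> //.
- move=> x'; have := xy x' y.
  rewrite addeAC leeD2rE// innerNl (innerC (adjoint _ _)) adjointP//.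
  move=> h; rewrite EFinN leeBlDr// (le_trans h)// leeD2l// lee_fin.
  by rewrite -Exy opprD addrACA subrr addr0 -(linearB A) innerC.
- move=> y'; have := xy x y'.
  rewrite -addeA leeD2lE// innerNl (innerC (adjoint _ _)) adjointP//.
  move=> h; rewrite EFinN leeBlDr// (le_trans h)// leeD2l// lee_fin.
  by rewrite -Exy opprD addrACA subrr add0r -(linearB B) innerC.
Qed.

End Saddle.

(** * Extended and real numbers *)

(** Weak lower semi-continuity bounds [f] and [g] from below separately, by reals
    [a] and [b]; this recombines the bounds before either of [f] and [g] is known
    to be finite at the weak limit. *)
Lemma lee_addP (R : realType) (s t : \bar R) (K : R) :
  s != -oo%E -> t != -oo%E ->
  (forall a b : R, (a%:E < s)%E -> (b%:E < t)%E -> a + b <= K) ->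
  (s + t <= K%:E)%E.
Proof.
case: s t => [r| |] [q| |]// _ _ H.
- rewrite -EFinD lee_fin; apply/ler_addgt0Pr => e e0.
  have := H (r - e / 2) (q - e / 2); rewrite !lte_fin.
  by rewrite !ltrBlDr !ltrDl divr_gt0// => /(_ isT isT); lra.
- have h1 : r - 1 < r by lra.
  exfalso; have := H (r - 1) (K - r + 2).
  by rewrite lte_fin ltry h1 => /(_ isT isT); lra.
- have h1 : q - 1 < q by lra.
  exfalso; have := H (K - q + 2) (q - 1).
  by rewrite lte_fin ltry h1 => /(_ isT isT); lra.
- exfalso; have := H K 1; rewrite !ltry => /(_ isT isT); lra.
Qed.

Section Sequences.
Variable R : realType.

Lemma decrease_cvg (E d : R ^nat) :
  (forall n, 0 <= E n) -> (forall n, 0 <= d n) ->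
  (forall n, E n.+1 + d n <= E n) ->
  cvgn E /\ d @ \oo --> (0 : R).
Proof.
move=> E0 d0 Ed.
have cE : cvgn E.
  apply: nonincreasing_is_cvgn; last by exists 0 => _ [n _ <-].
  by apply/nonincreasing_seqP => n; have := Ed n; have := d0 n; lra.
split=> //; apply: (@squeeze_cvgr _ _ _ _ (cst 0) (E \- [sequence E n.+1]_n)).
- by near=> n => /=; rewrite d0/= lerBrDl.
- exact: cvg_cst.
- rewrite -(subrr (limn E)); apply: cvgB => //.
  by rewrite cvg_shiftS.
Unshelve. all: by end_near. Qed.

Lemma sqr_le_cvg0 (s e : R ^nat) (M : R) :
  (forall n, s n ^+ 2 <= M * e n) -> e @ \oo --> (0 : R) ->
  s @ \oo --> (0 : R).
Proof.
move=> se e0; apply/cvgr0Pnorm_lt => eps eps0.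
have Me0 : (M * e n) @[n --> \oo] --> (0 : R).
  by rewrite -(mulr0 M); exact: cvgMr.
apply: filterS (cvgr_lt _ Me0 (eps ^+ 2) (exprn_gt0 _ eps0)) => n h.
rewrite -(ltr_pXn2r (n := 2))// ?nnegrE ?normr_ge0 ?(ltW eps0)//.
by rewrite real_normK ?num_real// (le_lt_trans (se n)).
Qed.

Lemma inner_cvg0 (V : hilbertType R) (v : V ^nat) (e : R ^nat) (a : R) (z : V) :
  0 < a -> (forall n, a * `|v n| ^+ 2 <= e n) -> e @ \oo --> (0 : R) ->
  '[z, v n] @[n --> \oo] --> (0 : R).
Proof.
move=> a0 ve; apply: (@sqr_le_cvg0 _ _ (`|z| ^+ 2 / a)) => n.
rewrite -[leLHS]real_normK ?num_real//.
have := inner_norm_le z (v n).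
rewrite -(ler_pXn2r (n := 2))// ?nnegrE ?mulr_ge0// => /le_trans; apply.
by rewrite exprMn -[leRHS]mulrA ler_wpM2l ?sqr_ge0// ler_pdivlMl.
Qed.

Lemma cauchy_schwarz_discriminant (a b c : R) :
  0 <= c -> (forall t, 0 <= a + 2 * t * b + t ^+ 2 * c) -> b ^+ 2 <= a * c.
Proof.
move=> c0 abc; have [c_eq0|cN0] := eqVneq c 0.
  have [->|b0] := eqVneq b 0; first by rewrite c_eq0 expr0n mulr0.
  have := abc (- (a + 1) / (2 * b)); rewrite c_eq0 mulr0 addr0.
  have -> : 2 * (- (a + 1) / (2 * b)) * b = - (a + 1) by field.
  lra.
have := abc (- b / c).
have -> : a + 2 * (- b / c) * b + (- b / c) ^+ 2 * c = (a * c - b ^+ 2) / c.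
  by field.
by rewrite ler_pdivlMr ?mul0r ?subr_ge0// lt_neqAle eq_sym cN0.
Qed.

End Sequences.

(** * The semi-inner product of the operator G *)

Section Gform.
Variables (R : realType) (X Y Z : hilbertType R).
Variables (B : {linear Y -> Z}).
Variables (P : {linear X -> X}) (Q : {linear Y -> Y}) (rho : R).
Hypotheses (rho0 : 0 < rho) (Bb : bounded_near B (nbhs 0)).
Hypotheses (Ppsd : psd_selfadjoint P) (Qpsd : psd_selfadjoint Q).
Implicit Types a b w : X * Y * Z.

Definition innerG a b : R := inner3 a (Gop B P Q rho b).

Lemma innerGE a b : innerG a b =
  '[a.1.1, P b.1.1] + (rho * '[B a.1.2, B b.1.2] + '[a.1.2, Q b.1.2])
  + rho^-1 * '[a.2, b.2].
Proof. by rewrite /innerG /inner3/= innerDr !innerZr adjointP. Qed.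

(** With [t] equal to 1 or -1 this is the expansion of the square of a sum or a
    difference; its nonnegativity for all [t] is what the Cauchy-Schwarz
    inequality comes from. *)
Lemma innerG_quad a b t : innerG (a + t *: b) (a + t *: b) =
  innerG a a + 2 * t * innerG a b + t ^+ 2 * innerG b b.
Proof.
have [[Ps _] [Qs _]] := (Ppsd, Qpsd).
rewrite !innerGE/= !linearD !linearZ/= !(innerDl, innerDr, innerZl, innerZr).
rewrite (innerC b.2 a.2) (innerC (B b.1.2) (B a.1.2)).
have -> : '[b.1.1, P a.1.1] = '[a.1.1, P b.1.1] by rewrite -Ps innerC.
have -> : '[b.1.2, Q a.1.2] = '[a.1.2, Q b.1.2] by rewrite -Qs innerC.
by ring.
Qed.

Lemma innerG_ge0 a : 0 <= innerG a a.
Proof.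
have [[_ P0] [_ Q0]] := (Ppsd, Qpsd).
rewrite innerGE addr_ge0// ?mulr_ge0 ?invr_ge0 ?inner_ge0 ?(ltW rho0)//.
by rewrite addr_ge0// addr_ge0// mulr_ge0 ?inner_ge0// ltW.
Qed.

Lemma innerG_cauchy_schwarz a b : innerG a b ^+ 2 <= innerG a a * innerG b b.
Proof.
apply: cauchy_schwarz_discriminant => [|t]; first exact: innerG_ge0.
rewrite -innerG_quad; exact: innerG_ge0.
Qed.

Lemma innerGBl a b w : innerG (a - b) w = innerG a w - innerG b w.
Proof. by rewrite /innerG /inner3/= !innerBl; ring. Qed.

Lemma innerGNl a w : innerG (- a) w = - innerG a w.
Proof. by rewrite /innerG /inner3/= !innerNl; ring. Qed.

End Gform.

(** * One step of the algorithm *)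

Section OneStep.
Variables (R : realType) (X Y Z : hilbertType R).
Variables (f : X -> \bar R) (g : Y -> \bar R).
Variables (A : {linear X -> Z}) (B : {linear Y -> Z}) (c : Z).
Variables (P : {linear X -> X}) (Q : {linear Y -> Y}) (rho : R).
Hypotheses (rho0 : 0 < rho).
Hypotheses (Ab : bounded_near A (nbhs 0)) (Bb : bounded_near B (nbhs 0)).

(** The sum of the two subgradient inequalities, with the multiplier update
    read as the gradient of the Lagrangian in its last variable. The semi-inner
    product of G collects the proximal terms; the last term is there because
    the first subproblem uses [y0] instead of the new [y]. *)
Lemma step_variational_inequality (x x0 : X) (y y0 : Y) (l l0 : Z) :
  subdifferential f x
    (- (adjoint A (l0 + rho *: (A x + (B y0 - c))) + P (x - x0))) ->
  subdifferential g y
    (- (adjoint B (l0 + rho *: (B y + (A x - c))) + Q (y - y0))) ->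
  l = l0 + rho *: (A x + B y - c) ->
  forall x' y' l',
  (f x + g y + ('[l', A x + B y - c])%:E <= f x' + g y' +
    ('[l, A x' + B y' - c]
     + innerG B P Q rho ((x', y', l') - (x, y, l)) ((x, y, l) - (x0, y0, l0))
     - rho * '[B (y - y0), (A x' + B y' - c) - (A x + B y - c)])%:E)%E.
Proof.
move=> fx gy lE x' y' l'.
rewrite -leeBrDr// -addeA -EFinB.
apply: (le_trans (subdifferential_add x' y' fx gy)).
rewrite leeD2l// -EFinN lee_fin le_eqVlt; apply/orP; left; apply/eqP.
rewrite innerGE//=.
have -> : l - l0 = rho *: (A x + B y - c) by rewrite lE addrC addKr.
rewrite !innerNl !innerDl (innerC (adjoint A _)) (innerC (adjoint B _)).
rewrite !adjointP// (innerC (P _)) (innerC (Q _)).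
move: (P (x - x0)) (Q (y - y0)) => p q.
have -> : A x + (B y0 - c) = (A x + B y - c) - B (y - y0).
  by rewrite linearB/= opprB -!addrA; congr (_ + _); rewrite addrCA subrKC addrC.
have -> : B y + (A x - c) = A x + B y - c by rewrite addrCA addrA.
have -> : A x' + B y' - c = (A x + B y - c) + (A (x' - x) + B (y' - y)).
  by rewrite !linearB/= [RHS]addrAC addrACA !subrKC.
rewrite lE; move: (A (x' - x)) (B (y' - y)) (B (y - y0)) (A x + B y - c).
move=> a b d r.
rewrite [r + _ - r]addrC addKr.
rewrite !(innerDl, innerDr, innerNl, innerNr, innerZl, innerZr).
rewrite (innerC a l0) (innerC b l0) (innerC a r) (innerC b r) (innerC a d).
rewrite (innerC b d).
by field; rewrite gt_eqF.
Qed.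

End OneStep.

(** * Descent along the iterates *)

Section Run.
Variables (R : realType) (X Y Z : hilbertType R).
Variables (f : X -> \bar R) (g : Y -> \bar R).
Variables (A : {linear X -> Z}) (B : {linear Y -> Z}) (c : Z).
Variables (P : {linear X -> X}) (Q : {linear Y -> Y}) (rho : R).
Hypotheses (rho0 : 0 < rho).
Hypotheses (Ab : bounded_near A (nbhs 0)) (Bb : bounded_near B (nbhs 0)).
Hypotheses (Ppsd : psd_selfadjoint P) (Qpsd : psd_selfadjoint Q).
Hypotheses (fp : proper_efun f) (fc : econvex f).
Hypotheses (gp : proper_efun g) (gc : econvex g).
Variables (x : X ^nat) (y : Y ^nat) (lam : Z ^nat).
Hypothesis run : proximal_ADMM f g A B P Q c rho x y lam.

Let u k : X * Y * Z := (x k, y k, lam k).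
Let du k : X * Y * Z := u k.+1 - u k.
Let res k : Z := A (x k) + B (y k) - c.
Let G := innerG B P Q rho.

Lemma iterate_fin_num k : f (x k.+1) \is a fin_num /\ g (y k.+1) \is a fin_num.
Proof.
by have [fx gy _] := run k; split; [exact: (eargmin_fin_num fp fx)|
  exact: (eargmin_fin_num gp gy)].
Qed.

Lemma x_subdifferential k : subdifferential f (x k.+1)
  (- (adjoint A (lam k + rho *: (A (x k.+1) + (B (y k) - c)))
      + P (x k.+1 - x k))).
Proof.
have [fx _ _] := run k; apply: prox_subproblem_subdifferential => // w.
by have := fx w; rewrite -!addrA.
Qed.

Lemma y_subdifferential k : subdifferential g (y k.+1)
  (- (adjoint B (lam k + rho *: (B (y k.+1) + (A (x k.+1) - c)))
      + Q (y k.+1 - y k))).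
Proof.
have [_ gy _] := run k; apply: prox_subproblem_subdifferential => // w.
have := gy w.
by rewrite !(addrA (B _)) !(addrC (B _) (A (x k.+1))).
Qed.

Lemma lam_increment k : lam k.+1 - lam k = rho *: res k.+1.
Proof. by have [_ _ ->] := run k; rewrite addrC addKr. Qed.

Lemma iterate_variational_inequality k x' y' l' :
  (f (x k.+1) + g (y k.+1) + ('[l', res k.+1])%:E <= f x' + g y' +
    ('[lam k.+1, A x' + B y' - c] + G ((x', y', l') - u k.+1) (du k)
     - rho * '[B (y k.+1 - y k), (A x' + B y' - c) - res k.+1])%:E)%E.
Proof.
apply: step_variational_inequality => //.
- exact: x_subdifferential.
- exact: y_subdifferential.
- by have [_ _] := run k.
Qed.

(** Monotonicity of the subdifferential of [g] at two consecutive iterates: the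
    opposite of [adjoint B] applied to the multiplier is a subgradient up to a
    proximal correction, and convexity of the square of the Q-norm makes the
    contributions of these corrections telescope. *)
Lemma cross_term_le k :
  '[B (y k.+2 - y k.+1), lam k.+2 - lam k.+1] <=
  1 / 2 * (sqnormD Q (y k.+1 - y k) - sqnormD Q (y k.+2 - y k.+1)).
Proof.
have [_ g1] := iterate_fin_num k; have [_ g2] := iterate_fin_num k.+1.
have := subdifferential_monotone g2 g1 (y_subdifferential k.+1)
  (y_subdifferential k).
have lamE j : lam j + rho *: (B (y j.+1) + (A (x j.+1) - c)) = lam j.+1.
  by have [_ _ ->] := run j; rewrite addrA (addrC (B _)).
rewrite !lamE; move: (y k.+2 - y k.+1) (y k.+1 - y k) => d d0.
rewrite opprK addrC opprD addrACA innerDl innerBl !(innerC _ d) !adjointP//.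
rewrite -innerBr.
have [Qs Q0] := Qpsd.
have := Q0 (d - d0); rewrite /sqnormD linearB/= !(innerBl, innerBr).
have -> : '[d0, Q d] = '[d, Q d0] by rewrite -Qs innerC.
lra.
Qed.

(** The variational inequality at the KKT point and the saddle point inequality
    at the iterate bound the same Lagrangian gap from both sides. *)
Lemma descent xb yb lb k : KKT_point f g A B c (xb, yb, lb) ->
  G (u k.+1 - (xb, yb, lb)) (du k) <= '[B (y k.+1 - y k), lam k.+1 - lam k].
Proof.
move=> /(KKT_saddle _ Ab Bb fp gp)[feas saddle].
have := saddle (x k.+1) (y k.+1).
have := iterate_variational_inequality k xb yb lb.
have [] := iterate_fin_num k.
have := fp.1 xb; have := gp.1 yb.
rewrite feas subrr sub0r inner0r add0r innerNr.
rewrite -(opprB (u k.+1)) {1}/G innerGNl -/G.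
rewrite lam_increment innerZr.
case: (f (x k.+1)) (g (y k.+1)) (f xb) (g yb) =>
  [a| |]// [b| |]// [a'| |] [b'| |]// _ _ _ _.
rewrite -!EFinD !lee_fin; lra.
Qed.

(** The residual is controlled because it is the multiplier increment divided
    by [rho]. *)
Lemma G_increment_ge k : [/\ sqnormD Q (y k.+1 - y k) <= G (du k) (du k),
  rho * `|B (y k.+1 - y k)| ^+ 2 + rho^-1 * `|lam k.+1 - lam k| ^+ 2
    <= G (du k) (du k)
  & rho * `|res k.+1| ^+ 2 <= G (du k) (du k)].
Proof.
have [[_ P0] [_ Q0]] := (Ppsd, Qpsd).
have p0 := P0 (x k.+1 - x k); have q0 := Q0 (y k.+1 - y k).
have rlE : rho^-1 * `|lam k.+1 - lam k| ^+ 2 = rho * `|res k.+1| ^+ 2.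
  rewrite lam_increment normrZ exprMn real_normK ?num_real//.
  by field; rewrite gt_eqF.
have b0 : 0 <= rho * `|B (y k.+1 - y k)| ^+ 2.
  by rewrite mulr_ge0 ?sqr_ge0// ltW.
have r0 : 0 <= rho * `|res k.+1| ^+ 2 by rewrite mulr_ge0 ?sqr_ge0// ltW.
rewrite /G innerGE//= -!normr2_inner rlE /sqnormD.
by split; lra.
Qed.

(** The squared G-distance to a KKT point need not decrease by itself: it is
    its sum with the squared Q-norm of the last [y] increment that decreases,
    by at least the squared G-norm of the next increment. The latter therefore
    tends to 0 and takes the correction with it. *)
Lemma fejer_cvg ub : KKT_point f g A B c ub ->
  cvgn (fun k => G (u k.+1 - ub) (u k.+1 - ub)) /\
  G (du k) (du k) @[k --> \oo] --> (0 : R).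
Proof.
case: ub => [[xb yb] lb] kkt; set ub := (xb, yb, lb).
pose q k := sqnormD Q (y k.+1 - y k).
pose E k := G (u k.+1 - ub) (u k.+1 - ub) + q k.
have q0 k : 0 <= q k by exact: Qpsd.2.
have G0 a : 0 <= G a a by exact: innerG_ge0.
have Edescent k : E k.+1 + G (du k.+1) (du k.+1) <= E k.
  have h1 := descent k.+1 kkt; have h2 := cross_term_le k.
  have -> : E k = G (u k.+2 - ub) (u k.+2 - ub)
      + 2 * (- 1) * G (u k.+2 - ub) (du k.+1)
      + (- 1) ^+ 2 * G (du k.+1) (du k.+1) + q k.
    rewrite /E; congr (_ + _); rewrite -innerG_quad// scaleN1r.
    have -> // : u k.+1 - ub = u k.+2 - ub - du k.+1.
    by rewrite addrAC /du subKr.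
  by rewrite /E /q; lra.
have [cE d0] : cvgn E /\ G (du k.+1) (du k.+1) @[k --> \oo] --> (0 : R).
  by apply: decrease_cvg => // k; rewrite addr_ge0.
have {}d0 : G (du k) (du k) @[k --> \oo] --> (0 : R).
  by rewrite -cvg_shiftS.
split=> //.
have qc : q @ \oo --> (0 : R).
  apply: (@squeeze_cvgr _ _ _ _ (cst 0) (fun k => G (du k) (du k))) => //.
    by near=> k => /=; rewrite q0/=; case: (G_increment_ge k).
  exact: cvg_cst.
have -> : (fun k => G (u k.+1 - ub) (u k.+1 - ub)) = E \- q.
  by apply/funext => k; rewrite /E/= addrK.
by apply: is_cvgB => //; apply: cvgP qc.
Unshelve. all: by end_near. Qed.

Hypothesis kkt_ex : exists ub : X * Y * Z, KKT_point f g A B c ub.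

Lemma increment_cvg0 : G (du k) (du k) @[k --> \oo] --> (0 : R).
Proof. by have [ub /fejer_cvg[]] := kkt_ex. Qed.

Lemma res_weak_cvg0 z : '[z, res k.+1] @[k --> \oo] --> (0 : R).
Proof.
apply: inner_cvg0 rho0 _ increment_cvg0 => k.
by have [] := G_increment_ge k.
Qed.

Lemma Bdy_weak_cvg0 z : '[z, B (y k.+1 - y k)] @[k --> \oo] --> (0 : R).
Proof.
apply: inner_cvg0 rho0 _ increment_cvg0 => k.
have [_ + _] := G_increment_ge k; apply: le_trans.
by rewrite lerDl mulr_ge0 ?sqr_ge0// invr_ge0 ltW.
Qed.

Lemma Bdy_res_cvg0 : '[B (y k.+1 - y k), res k.+1] @[k --> \oo] --> (0 : R).
Proof.
apply/cvgr0Pnorm_lt => e e0; have re0 : 0 < rho * e by rewrite mulr_gt0.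
apply: filterS (cvgr_lt _ increment_cvg0 _ re0) => k h.
have [_ h1 h2] := G_increment_ge k.
have := inner_norm_le (B (y k.+1 - y k)) (res k.+1).
have b2 : rho * `|B (y k.+1 - y k)| ^+ 2 < rho * e.
  rewrite (le_lt_trans _ h)// (le_trans _ h1)// lerDl.
  by rewrite mulr_ge0 ?sqr_ge0// invr_ge0 ltW.
have r2 := le_lt_trans h2 h.
rewrite !ltr_pM2l// in b2 r2.
have := sqr_ge0 (`|B (y k.+1 - y k)| - `|res k.+1|).
nra.
Qed.

(** The G-norm of [w - u k.+1] is bounded since the G-distance of the iterates
    to a KKT point converges. *)
Lemma G_increment_cvg0 w : G (w - u k.+1) (du k) @[k --> \oo] --> (0 : R).
Proof.
have [ub kkt] := kkt_ex; have [cub _] := fejer_cvg kkt.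
have [M uM] := cvg_has_ub cub.
have G0 a : 0 <= G a a by exact: innerG_ge0.
apply: (@sqr_le_cvg0 _ _ _ (2 * G (w - ub) (w - ub) + 2 * M)) increment_cvg0.
move=> k; apply: (le_trans (innerG_cauchy_schwarz rho0 Bb Ppsd Qpsd _ _)).
apply: ler_wpM2r; first exact: G0.
have := G0 ((w - ub) + 1 *: (u k.+1 - ub)).
have : G (w - u k.+1) (w - u k.+1) =
    G ((w - ub) + (-1) *: (u k.+1 - ub)) ((w - ub) + (-1) *: (u k.+1 - ub)).
  by rewrite scaleN1r opprB addrA subrK.
rewrite /G !innerG_quad// -/G => -> h.
have : G (u k.+1 - ub) (u k.+1 - ub) <= M.
  rewrite -[leLHS](ger0_norm (G0 _)); apply: uM.
  by exists k.
lra.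
Qed.

(** * Weak limits of the iterates *)

Variable M : R.
Hypotheses (flsc : lower_semicontinuous f) (glsc : lower_semicontinuous g).
Hypotheses (xM : forall k, `|x k| <= M) (yM : forall k, `|y k| <= M).

(** All error terms of the variational inequality vanish in the limit, what
    remains being the Lagrangian inequality at the weak limit. *)
Lemma weak_limit_KKT (m : nat -> nat) l :
  m @ \oo --> \oo -> weak_cvg (fun k => u (m k).+1) l ->
  KKT_point f g A B c l.
Proof.
case: l => [[xd yd] ld] moo ul.
have [/= xw yw lw] := weak_cvg_components ul.
have sub0 (s : R ^nat) : s @ \oo --> (0 : R) -> s (m k) @[k --> \oo] --> (0 : R).
  by move=> s0; exact: (cvg_comp _ _ moo s0).
have feas : A xd + B yd = c.
  apply/eqP; rewrite -subr_eq0; apply/eqP; set z := _ - c.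
  have h : '[z, res (m k).+1] @[k --> \oo] --> '[z, A xd + B yd - c].
    rewrite /res innerBr innerDr.
    under eq_fun do rewrite innerBr innerDr.
    apply: cvgB; last exact: cvg_cst.
    apply: cvgD; apply: weak_cvg_inner.
      by apply: (weak_cvg_linear (T := A)) xw; exact: bounded_linear_continuous.
    by apply: (weak_cvg_linear (T := B)) yw; exact: bounded_linear_continuous.
  have zz : '[z, z] = 0 :=
    cvg_unique (@Rhausdorff R) h (sub0 _ (res_weak_cvg0 z)).
  by apply/eqP; rewrite -normr_eq0 -sqrf_eq0 normr2_inner zz.
apply/KKT_saddle => //; split=> // x' y'.
have := fp.1 x'; have := gp.1 y'.
case fxE : (f x') => [a'| |]//; case gyE : (g y') => [b'| |]// _ _;
  rewrite ?leey//.
rewrite -!EFinD; apply: lee_addP; [exact: fp.1|exact: gp.1|move=> a b fa gb].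
set r := A x' + B y' - c.
(* The third component of the test point is free; with 0 the residual of the
   iterate drops out of the left-hand side. *)
pose err k := G ((x', y', 0) - u k.+1) (du k)
     - rho * '[B (y k.+1 - y k), r - res k.+1].
have err0 : err @ \oo --> (0 : R).
  have -> : 0 = 0 - rho * (0 - 0) :> R by ring.
  apply: cvgB; first exact: G_increment_cvg0.
  apply: cvgMr; under eq_fun do rewrite innerBr.
  apply: cvgB; last exact: Bdy_res_cvg0.
  by under eq_fun do rewrite innerC; exact: Bdy_weak_cvg0.
have lim : a' + b' + ('[lam (m k).+1, r] + err (m k)) @[k --> \oo] -->
    a' + b' + '[ld, r].
  apply: cvgD; first exact: cvg_cst.
  rewrite -(addr0 '[ld, r]); apply: cvgD; last exact: sub0.
  by rewrite innerC; under eq_fun do rewrite innerC; exact: weak_cvg_inner.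
apply: (cvgr_to_ge lim).
near=> k.
have fak : (a%:E < f (x (m k).+1))%E.
  near: k; exact: (weak_lower_semicontinuous flsc fc (fun k => xM _) xw fa).
have gbk : (b%:E < g (y (m k).+1))%E.
  near: k; exact: (weak_lower_semicontinuous glsc gc (fun k => yM _) yw gb).
have := iterate_variational_inequality (m k) x' y' 0.
have [] := iterate_fin_num (m k).
rewrite fxE gyE (innerC 0) inner0r adde0 -/r.
case: (f _) fak (g _) gbk => [fk| |]// + [gk| |]// + _ _.
by rewrite !lte_fin -!EFinD lee_fin /err; lra.
Unshelve. all: by end_near. Qed.

(** Opial's argument: the squared G-distances to [l] and to [l'] both converge,
    hence so does their difference, which is affine in the iterate. Its limits
    along the two subsequences must agree. *)
Lemma weak_limits_G m m' l l' :
  m @ \oo --> \oo -> weak_cvg (fun k => u (m k).+1) l ->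
  m' @ \oo --> \oo -> weak_cvg (fun k => u (m' k).+1) l' ->
  G (l' - l) (l' - l) = 0.
Proof.
move=> moo ul moo' ul'.
have [cl _] := fejer_cvg (weak_limit_KKT moo ul).
have [cl' _] := fejer_cvg (weak_limit_KKT moo' ul').
set e := l' - l.
pose s k := G (u k.+1 - l') e.
have sE : s = fun k => 1 / 2 * (G (u k.+1 - l) (u k.+1 - l) -
   G (u k.+1 - l') (u k.+1 - l') - G e e).
  apply/funext => k.
  have -> : u k.+1 - l = (u k.+1 - l') + 1 *: e.
    by rewrite scale1r /e addrA subrK.
  by rewrite /s /G innerG_quad//; field.
have [L sL] : exists L : R, s @ \oo --> L.
  apply/cvg_ex; rewrite sE; apply: is_cvgMr.
  by apply: is_cvgB; [exact: is_cvgB|exact: is_cvg_cst].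
have slim (n : nat -> nat) v :
    weak_cvg (fun k => u (n k).+1) v -> n @ \oo --> \oo -> L = G (v - l') e.
  move=> uv noo.
  apply: (cvg_unique (@Rhausdorff R) (F := s \o n @ \oo)).
    exact: (cvg_comp _ _ noo sL).
  have -> : s \o n = fun k => G (u (n k).+1) e - G l' e.
    by apply/funext => k; rewrite /s /G/= innerGBl.
  rewrite /G innerGBl; apply: cvgB; last exact: cvg_cst.
  exact: weak_cvg_inner3.
have := slim _ _ ul moo.
rewrite (slim _ _ ul' moo') -[l - l']opprB -/e /G innerGNl innerGBl; lra.
Qed.

End Run.

Theorem theorem2p7 (R : realType) (X Y Z : hilbertType R)
    (f : X -> \bar R) (g : Y -> \bar R)
    (A : {linear X -> Z}) (B : {linear Y -> Z})
    (P : {linear X -> X}) (Q : {linear Y -> Y})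
    (c : Z) (rho : R)
    (x : X ^nat) (y : Y ^nat) (lam : Z ^nat) (udag : X * Y * Z) :
  let u : (X * Y * Z)%type ^nat := fun k => (x k, y k, lam k) in
  0 < rho ->
  bounded_near A (nbhs 0) -> bounded_near B (nbhs 0) ->
  bounded_near P (nbhs 0) -> bounded_near Q (nbhs 0) ->
  psd_selfadjoint P -> psd_selfadjoint Q ->
  proper_efun f -> lower_semicontinuous f -> econvex f ->
  proper_efun g -> lower_semicontinuous g -> econvex g ->
  (exists ubar : X * Y * Z, KKT_point f g A B c ubar) ->
  proximal_ADMM f g A B P Q c rho x y lam ->
  bounded_fun u ->
  weak_cluster_point u udag ->
  KKT_point f g A B c udag /\
  forall ustar : X * Y * Z, weak_cluster_point u ustar ->
    Gnorm B P Q rho (ustar - udag) = 0.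
Proof.
move=> u rho0 Ab Bb _ _ Ppsd Qpsd fp flsc fc gp glsc gc kkt run [M [_ uM]] udagP.
have [xM yM] : (forall k, `|x k| <= M + 1) /\ (forall k, `|y k| <= M + 1).
  by split=> k; apply: le_trans (uM (M + 1) _ k I); rewrite ?ltrDl//;
    rewrite /= /Num.norm/= !le_max lexx ?orbT.
have [m moo mw] := weak_cluster_shift udagP.
split; first by apply: weak_limit_KKT run kkt _ flsc glsc xM yM _ _ moo mw.
move=> ustar /weak_cluster_shift[m' moo' mw'].
rewrite /Gnorm -/(innerG B P Q rho _ _).
by rewrite (weak_limits_G _ _ _ _ _ _ _ _ _ run kkt flsc glsc xM yM
  moo mw moo' mw') ?sqrtr0.
Qed.
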